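(* Let $T$ be a densely defined closed antilinear operator on a complex Hilbert space $\mathcal{H}$. Then $T$ is normal if and only if there exists an antiunitary operator $V$ on $\mathcal{H}$ such that $$T=V|T|=|T|V\quad\text{and}\quad T^\dagger=V^\dagger|T|=|T|V^\dagger.$$ Moreover, in this case, $T^2$ is a linear normal operator and $$T^2=V^2|T|^2=|T|^2V^2.$$
   Context: Scalar products are linear in the first variable; operators may be unbounded, with products on natural domains and equalities including domains. An operator $T$ on a linear subspace $\mathcal{D}(T)$ is antilinear if $T(\alpha x+\beta y)=\overline{\alpha}\,Tx+\overline{\beta}\,Ty$ for $\alpha,\beta\in\mathbb{C}$. For a densely defined antilinear $T$ on $\mathcal{H}$, the adjoint $T^\dagger$ is the antilinear operator whose domain consists of all $y\in\mathcal{H}$ for which there is $u\in\mathcal{H}$ with $\langle Tx,y\rangle=\langle u,x\rangle$ for all $x\in\mathcal{D}(T)$; then $T^\dagger y:=u$. $T$ is normal if $T^\dagger T=TT^\dagger$. For densely defined closed antilinear $T$, $T^\dagger T$ is a positive self-adjoint linear operator and $|T|:=\sqrt{T^\dagger T}$. An antiunitary operator is an antilinear bijection $V$ of $\mathcal{H}$ with $\|Vx\|=\|x\|$ for all $x\in\mathcal{H}$. A linear normal operator is a densely defined closed linear operator $N$ with $N^*N=NN^*$. *)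

(* Defs.v *)
From HB Require Import structures.
From mathcomp Require Import all_boot all_order all_algebra.
From mathcomp Require Import all_classical all_reals all_analysis.
From mathcomp Require Import complex.

Set Implicit Arguments.
Unset Strict Implicit.
Unset Printing Implicit Defensive.

Import Order.TTheory GRing.Theory Num.Theory.
Import numFieldNormedType.Exports.

Local Open Scope classical_set_scope.
Local Open Scope ring_scope.
Local Open Scope complex_scope.

(* Forms of type {dot H for Num.conj} are positive definite, conjugate
   symmetric, and linear in their first argument. *)
HB.mixin Record hasInnerProduct (R : realType) H
    of CompleteNormedModule R[i] H := {
  inner : {dot H for Num.conj} ;
  inner_norm : forall x : H, inner x x = `|x| ^+ 2
}.

#[short(type="hilbertType")]
HB.structure Definition Hilbert (R : realType) :=
  {H of hasInnerProduct R H & CompleteNormedModule R[i] H}.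

Notation "⟨ x , y ⟩" := (inner x y)
  (at level 0, x, y at level 99, format "⟨ x ,  y ⟩") : ring_scope.

(* A partially defined operator sends x to None when x is outside its domain,
   so that (by functional extensionality) Leibniz equality of operators is
   equality of the domains together with equality of the values on them. *)
Definition operator (H : Type) : Type := H -> option H.

Definition total_op (H : Type) (V : H -> H) : operator H := fun x => Some (V x).

(* Product A B on its natural domain {x in dom B | B x in dom A}. *)
Definition op_mul (H : Type) (A B : operator H) : operator H :=
  fun x => obind A (B x).

Declare Scope operator_scope.
Delimit Scope operator_scope with op.
Bind Scope operator_scope with operator.
Notation "A * B" := (op_mul A B) : operator_scope.
Notation "A ²" := (op_mul A A)
  (at level 1, left associativity, format "A ²") : operator_scope.

(* [some_elt P] is an element of P (the only one if P is a singleton), or None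
   if P is empty. *)
Definition some_elt (X : Type) (P : set X) : option X :=
  if pselect (exists u, P u) is left h then Some (projT1 (cid h)) else None.

Section Operators.
Variables (R : realType) (H : hilbertType R).
Implicit Types (A N S T : operator H) (V : H -> H) (x y u v : H) (a b : R[i]).

Definition dom T : set H := [set x | isSome (T x)].

Definition graph T : set (H * H) := [set p | T p.1 = Some p.2].

(* In both definitions the domain is required to be a linear subspace. *)
Definition linear_op T : Prop :=
  T 0 = Some 0 /\
  forall a b x y u v, T x = Some u -> T y = Some v ->
    T (a *: x + b *: y) = Some (a *: u + b *: v).

Definition antilinear_op T : Prop :=
  T 0 = Some 0 /\
  forall a b x y u v, T x = Some u -> T y = Some v ->
    T (a *: x + b *: y) = Some (Num.conj a *: u + Num.conj b *: v).

Definition densely_defined T : Prop := dense (dom T).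

Definition closed_op T : Prop := closed (graph T).

(* The vector u is unique when the operator is densely defined. *)
Definition linear_adj N : operator H := fun y =>
  some_elt [set u | forall x v, N x = Some v -> ⟨v, y⟩ = ⟨x, u⟩].

Definition antilinear_adj T : operator H := fun y =>
  some_elt [set u | forall x v, T x = Some v -> ⟨v, y⟩ = ⟨u, x⟩].

Definition positive_op A : Prop :=
  forall x v, A x = Some v -> 0 <= ⟨v, x⟩.

Definition self_adjoint A : Prop :=
  [/\ linear_op A, densely_defined A & linear_adj A = A].

Definition linear_normal N : Prop :=
  [/\ linear_op N, densely_defined N, closed_op N &
      (linear_adj N * N = N * linear_adj N)%op].

Definition antilinear_normal T : Prop :=
  (antilinear_adj T * T = T * antilinear_adj T)%op.

(* The positive self-adjoint square root, which exists and is unique when A is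
   itself positive and self-adjoint; the default value A is used only if there
   is no such root. *)
Definition op_sqrt A : operator H :=
  xget A [set S | [/\ self_adjoint S, positive_op S & (S ² = A)%op]].

Definition op_abs T : operator H := op_sqrt (antilinear_adj T * T)%op.

Definition antiunitary V : Prop :=
  [/\ antilinear_op (total_op V), bijective V & forall x, `|V x| = `|x|].

End Operators.

Notation "T ^†" := (antilinear_adj T)
  (at level 1, left associativity, format "T ^†") : operator_scope.
Notation "`| T |" := (op_abs T) : operator_scope.

(* Main.v *)
Require Import Defs.
From mathcomp Require Import all_boot all_order all_algebra.
From mathcomp Require Import all_classical all_reals all_analysis.
From mathcomp Require Import complex.
From mathcomp Require Import ring lra.

(* Both adjoints are adjoints for the real inner product Re<x, y>, so linear and
   antilinear operators are treated alike as real-linear ones. Projecting (x, 0)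
   on the graph of T gives the bounded resolvent B = (1 + T^† T)^-1. With
   C = B^(1/2) and D = (1 - B)^(1/2), the root of T^† T is {(Cz, Dz)}.
   If T is normal then (x, y) is in the graph of T iff T B x = B y, and the same
   holds for S = |T|. Since |S B x| = |T B x|, the map S B x |-> T B x extends to
   an antiunitary V, completed by a conjugation on the common kernel, which is
   the complement of both ranges. V commutes with B, so that T = V S by the
   description of the graphs. By uniqueness of positive square roots,
   S B = C D, which commutes with everything that commutes with B; hence
   V S = S V. *)

Set Implicit Arguments.
Unset Strict Implicit.
Unset Printing Implicit Defensive.

Import Order.TTheory GRing.Theory Num.Theory.
Import numFieldNormedType.Exports.

Local Open Scope classical_set_scope.
Local Open Scope ring_scope.
Local Open Scope complex_scope.

(** * The real inner product *)

Section RealInnerProduct.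
Variables (R : realType) (H : hilbertType R).
Implicit Types (x y z u v w : H) (a b c r : R).

Definition rinner x y : R := complex.Re ⟨x, y⟩.

Lemma innerC x y : ⟨x, y⟩ = Num.conj ⟨y, x⟩.
Proof. by rewrite hermC expr0 mul1r. Qed.

Lemma rinnerC x y : rinner x y = rinner y x.
Proof. by rewrite /rinner innerC; case: ⟨y, x⟩. Qed.

Lemma rinnerDl x y z : rinner (x + y) z = rinner x z + rinner y z.
Proof. by rewrite /rinner linearDl raddfD. Qed.

Lemma rinnerZl a x z : rinner (a%:C *: x) z = a * rinner x z.
Proof.
rewrite /rinner linearZl_LR /=; case: ⟨x, z⟩ => p q /=.
by rewrite mul0r subr0.
Qed.

Lemma rinnerNl x z : rinner (- x) z = - rinner x z.
Proof. by rewrite /rinner linearNl raddfN. Qed.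

Lemma rinner0l z : rinner 0 z = 0.
Proof. by rewrite /rinner linear0l. Qed.

Lemma rinnerDr x y z : rinner z (x + y) = rinner z x + rinner z y.
Proof. by rewrite !(rinnerC z) rinnerDl. Qed.

Lemma rinnerZr a x z : rinner z (a%:C *: x) = a * rinner z x.
Proof. by rewrite !(rinnerC z) rinnerZl. Qed.

Lemma rinnerNr x z : rinner z (- x) = - rinner z x.
Proof. by rewrite !(rinnerC z) rinnerNl. Qed.

Lemma rinner0r z : rinner z 0 = 0.
Proof. by rewrite rinnerC rinner0l. Qed.

Definition rinnerE := (rinnerDl, rinnerDr, rinnerNl, rinnerNr, rinnerZl,
  rinnerZr, rinner0l, rinner0r).

(** Linearity in the first variable gives ⟨x, i y⟩ = -i ⟨x, y⟩, whose real part is the imaginary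
    part of ⟨x, y⟩. *)
Lemma inner_rinner x y : ⟨x, y⟩ = rinner x y +i* rinner x ('i *: y).
Proof.
rewrite /rinner linearZr_LR /=; case: ⟨x, y⟩ => p q /=.
by simpc.
Qed.

Lemma rinnerii x y : rinner ('i *: x) ('i *: y) = rinner x y.
Proof.
rewrite /rinner linearZl_LR linearZr_LR /=; case: ⟨x, y⟩ => p q /=.
by simpc.
Qed.

Lemma scaleii x : 'i *: ('i *: x) = - x.
Proof. by rewrite scalerA -expr2 sqr_i scaleN1r. Qed.

Lemma rinneriC x y : rinner ('i *: x) y = - rinner x ('i *: y).
Proof. by rewrite -rinnerii scaleii rinnerNl. Qed.

Lemma rinnerix x : rinner x ('i *: x) = 0.
Proof. by have := rinneriC x x; rewrite rinnerC => ?; lra. Qed.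

Lemma scaleCE (c : R[i]) x :
  c *: x = (complex.Re c)%:C *: x + (complex.Im c)%:C *: ('i *: x).
Proof.
rewrite scalerA -scalerDl; congr (_ *: _); case: c => p q /=.
by simpc.
Qed.

Lemma sqr_normE x : `|x| ^+ 2 = (rinner x x)%:C.
Proof. by rewrite -inner_norm inner_rinner rinnerix. Qed.

Lemma rinner_ge0 x : 0 <= rinner x x.
Proof. by rewrite -lecR -sqr_normE exprn_ge0. Qed.

Lemma rinner_eq0 x : rinner x x = 0 -> x = 0.
Proof.
move=> x0; apply/eqP; rewrite -normr_eq0 -sqrf_eq0 sqr_normE x0.
by rewrite rmorph0.
Qed.

Lemma rinner_inj x y : (forall z, rinner x z = rinner y z) -> x = y.
Proof.
move=> xy; apply/eqP; rewrite -subr_eq0; apply/eqP/rinner_eq0.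
by rewrite rinnerDl rinnerNl xy subrr.
Qed.

Definition rnorm x : R := Num.sqrt (rinner x x).

Lemma sqr_rnorm x : rnorm x ^+ 2 = rinner x x.
Proof. by rewrite sqr_sqrtr // rinner_ge0. Qed.

Lemma rnorm_ge0 x : 0 <= rnorm x.
Proof. exact: sqrtr_ge0. Qed.

Lemma normE x : `|x| = (rnorm x)%:C.
Proof.
apply/eqP; rewrite -(@eqrXn2 _ 2) //; last by rewrite lecR rnorm_ge0.
by rewrite sqr_normE -sqr_rnorm rmorphXn.
Qed.

Lemma rnormD x y : rnorm (x + y) <= rnorm x + rnorm y.
Proof. by rewrite -lecR rmorphD /= -!normE ler_normD. Qed.

Lemma rnormN x : rnorm (- x) = rnorm x.
Proof. by rewrite /rnorm rinnerNl rinnerNr opprK. Qed.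

Lemma rnormB x y : rnorm (x - y) = rnorm (y - x).
Proof. by rewrite -rnormN opprB. Qed.

Lemma rnormZ a x : rnorm (a%:C *: x) = `|a| * rnorm x.
Proof.
by rewrite /rnorm rinnerZl rinnerZr mulrA -expr2 sqrtrM ?sqr_ge0// sqrtr_sqr.
Qed.

Lemma rnorm_le a x : 0 <= a -> (rnorm x <= a) = (rinner x x <= a ^+ 2).
Proof. by move=> a0; rewrite -sqr_rnorm ler_sqr ?nnegrE ?rnorm_ge0. Qed.

Lemma ler_rnorm x y : (rnorm x <= rnorm y) = (rinner x x <= rinner y y).
Proof. by rewrite rnorm_le ?rnorm_ge0// sqr_rnorm. Qed.

Lemma rnorm_eq0 x : rnorm x <= 0 -> x = 0.
Proof.
move=> x0; apply: rinner_eq0; rewrite -sqr_rnorm.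
have /eqP-> : rnorm x == 0 by rewrite eq_le x0 rnorm_ge0.
by rewrite expr0n.
Qed.

Lemma CauchySchwarz_rinner x y : `|rinner x y| <= rnorm x * rnorm y.
Proof.
rewrite -ler_sqr ?nnegrE ?mulr_ge0 ?rnorm_ge0//.
rewrite exprMn !sqr_rnorm real_normK ?num_real//.
have [/rinner_eq0->|y0] := eqVneq (rinner y y) 0.
  by rewrite !rinner0r mulr0 expr0n.
(* With ⟨ , ⟩ read as [rinner], this square expands to |y|^2 (|x|^2 |y|^2 - ⟨x, y⟩^2). *)
have := rinner_ge0 ((rinner y y)%:C *: x - (rinner x y)%:C *: y).
rewrite !rinnerE (rinnerC y x) => h.
have yy : 0 < rinner y y by rewrite lt_def y0 rinner_ge0.
rewrite -subr_ge0 -(pmulr_rge0 _ yy); lra.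
Qed.

End RealInnerProduct.

(** * Completeness and projections *)

Section Topology.
Variables (R : realType) (H : hilbertType R).
Implicit Types (x y z u v w : H) (G : set (H * H)).

(** Radii of balls in [H] are elements of [R[i]]; this brings them back to the reals. *)
Lemma gt0_complexE (e : R[i]) : 0 < e -> exists2 r : R, 0 < r & e = r%:C.
Proof. by case: e => a b; rewrite ltcE/= => /andP[/eqP -> a0]; exists a. Qed.

Lemma ball_rnorm x y (e : R) : ball x e%:C y = (rnorm (x - y) < e).
Proof. by rewrite -ball_normE /ball_/= normE ltcR. Qed.

Lemma inv_succ_gt0 n : 0 < n.+1%:R^-1 :> R.
Proof. by rewrite invr_gt0 ltr0n. Qed.

Lemma inv_succ_small (e : R) : 0 < e -> exists n, n.+1%:R^-1 < e.
Proof.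
move=> e0; exists (Num.truncn e^-1).
by rewrite invf_plt ?posrE ?ltr0n// truncnS_gt.
Qed.

(** The Archimedean form in which later limit arguments end. *)
Lemma le_inv_succ (a c : R) : (forall n, a <= c * n.+1%:R^-1) -> a <= 0.
Proof.
move=> ac; rewrite leNgt; apply/negP => a0.
have c0 : 0 < c.
  by have := lt_le_trans a0 (ac 0%N); rewrite invr1 mulr1.
have [n] := inv_succ_small (divr_gt0 a0 c0).
by rewrite ltr_pdivlMr// mulrC ltNge ac.
Qed.

(** The rate survives in the limit: if |l - u n| > r n, some u m close to l with m >= n would
    violate the Cauchy bound. *)
Lemma cauchy_rnorm (u : nat -> H) (r : nat -> R) :
  (forall n m, (n <= m)%N -> rnorm (u m - u n) <= r n) ->
  (forall e : R, 0 < e -> exists n, r n < e) ->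
  exists l, forall n, rnorm (l - u n) <= r n.
Proof.
move=> ur r0.
have uC : cauchy (u @ \oo).
  apply/cauchy_exP => e /gt0_complexE[e' e'0 ->].
  have [n rn] := r0 _ e'0; exists (u n).
  exists n => // m /= nm.
  by rewrite ball_rnorm rnormB (le_lt_trans (ur _ _ nm)).
have /cauchy_cvgP/cvg_ex[l ul] := uC.
exists l => n; rewrite leNgt; apply/negP => rl.
have e0 : 0 < rnorm (l - u n) - r n by rewrite subr_gt0.
have : \forall m \near \oo, ball l (rnorm (l - u n) - r n)%:C (u m).
  by apply: ul; apply: nbhsx_ballx; rewrite ltcR.
case=> k _ kP; have := kP (maxn n k) (leq_maxr _ _).
rewrite ball_rnorm => lt1.
have := rnormD (l - u (maxn n k)) (u (maxn n k) - u n).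
rewrite addrA subrK => le2.
have := ur _ _ (leq_maxl n k) => le3; lra.
Qed.

(** Membership of (u, v) in the closure of [G], with real radii. *)
Definition near_pair G u v := forall e : R, 0 < e ->
  exists p, [/\ G p, rnorm (u - p.1) < e & rnorm (v - p.2) < e].

Lemma closed_near_pair G : closed G <-> forall u v, near_pair G u v -> G (u, v).
Proof.
split=> [cG u v Guv|Gc [u v] clG].
  apply: cG => B /nbhs_ballP[e /= e0 eB].
  have [e' e'0 ee'] := gt0_complexE e0.
  have [[a b] /= [Gab ua vb]] := Guv _ e'0.
  exists (a, b); split=> //; apply: eB; rewrite ee'.
  by split; rewrite ball_rnorm.
apply: Gc => e e0.
have /clG : nbhs (u, v) (ball (u, v) e%:C) by apply: nbhsx_ballx; rewrite ltcR.
by case=> -[a b] [Gab []]; rewrite /= !ball_rnorm; exists (a, b).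
Qed.

Lemma dense_rnorm (D : set H) :
  dense D <-> forall x (e : R), 0 < e -> exists2 w, D w & rnorm (x - w) < e.
Proof.
split=> [dD x e e0|nD O [x Ox] oO].
  have e0C : 0 < e%:C by rewrite ltcR.
  have [|w [/= xw Dw]] := dD (ball x e%:C)° _ (@open_interior _ _).
    by exists x; exact: nbhsx_ballx.
  by exists w; rewrite // -ball_rnorm; exact: interior_subset xw.
have /nbhs_ballP[e /= e0 eO] : nbhs x O by exact: open_nbhs_nbhs.
have [e' e'0 ee'] := gt0_complexE e0.
have [w Dw xw] := nD x _ e'0; exists w; split=> //.
by apply: eO; rewrite ee' ball_rnorm.
Qed.

(** By Pythagoras no point of [D] is closer to x than |x|, which contradicts density at radius |x|
    unless x = 0. *)
Lemma dense_total (D : set H) : dense D ->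
  forall x, (forall w, D w -> rinner x w = 0) -> x = 0.
Proof.
move/dense_rnorm => dD x xD; apply/rnorm_eq0; rewrite leNgt; apply/negP => x0.
have [w Dw] := dD x _ x0; rewrite ltNge => /negP; apply.
rewrite ler_rnorm !rinnerE (rinnerC w x) (xD _ Dw).
by have := rinner_ge0 w; lra.
Qed.

Definition rsubspace G := G (0, 0) /\ forall (r : R) p q, G p -> G q ->
  G (p.1 + r%:C *: q.1, p.2 + r%:C *: q.2).

(* (u, v) is the orthogonal projection of (x, 0) on the closure of G. *)
Lemma projection G x : rsubspace G -> exists u v, near_pair G u v /\
  forall p, G p -> rinner (x - u) p.1 = rinner v p.2.
Proof.
move=> [G0 GD].
(* The squared distance from (x, 0) to p in H × H. *)
pose f (p : H * H) := rinner (x - p.1) (x - p.1) + rinner p.2 p.2.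
have f0 p : 0 <= f p by rewrite addr_ge0 ?rinner_ge0.
have fhas : has_inf (f @` G).
  by split; [exists (f (0, 0)), (0, 0)|exists 0 => _ [p _ <-]].
pose d := inf (f @` G).
have df p : G p -> d <= f p.
  by move=> Gp; apply: inf_lbound; [case: fhas|exists p].
pose r n : R := n.+1%:R^-1.
have r_gt0 n : 0 < r n by exact: inv_succ_gt0.
have exP n : exists p, G p /\ f p <= d + r n ^+ 2 / 4.
  have e0 : 0 < r n ^+ 2 / 4 by rewrite divr_gt0 ?exprn_gt0 ?ltr0n.
  by have [_ [p Gp <-] /ltW lp] := inf_adherent e0 fhas; exists p.
pose s n := projT1 (cid (exP n)).
have sG n : G (s n) by rewrite /s; case: cid => p [].
have sf n : f (s n) <= d + r n ^+ 2 / 4 by rewrite /s; case: cid => p [].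
have rle n m : (n <= m)%N -> r m <= r n.
  by move=> nm; rewrite lef_pV2 ?posrE ?ltr0n// ler_nat.
have sC n m : (n <= m)%N ->
    rinner ((s m).1 - (s n).1) ((s m).1 - (s n).1) +
    rinner ((s m).2 - (s n).2) ((s m).2 - (s n).2) <= r n ^+ 2.
  (* The nested [GD] builds the midpoint of [s n] and [s m]. Its distance is at least [d], so the
     parallelogram law applies; the factor 1/4 in the choice of [s] makes the bound exactly
     [r n ^+ 2]. *)
  move=> nm; have := df _ (GD (2^-1) _ _ (GD (-1 + 2^-1) _ _ (sG n) (sG n)) (sG m)).
  have := sf n; have := sf m.
  have : r m ^+ 2 <= r n ^+ 2.
    by rewrite ler_sqr ?nnegrE ?(ltW (r_gt0 _))// rle.
  rewrite /f /=; case: (s n) => a b; case: (s m) => a' b' /=.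
  rewrite !rinnerE (rinnerC a x) (rinnerC a' x) (rinnerC a' a) (rinnerC b' b).
  lra.
have small e : 0 < e -> exists n, r n < e by exact: inv_succ_small.
have [|u uP] := @cauchy_rnorm (fun n => (s n).1) r _ small.
  move=> n m /sC; rewrite rnorm_le ?(ltW (r_gt0 _))//.
  by have := rinner_ge0 ((s m).2 - (s n).2); lra.
have [|v vP] := @cauchy_rnorm (fun n => (s n).2) r _ small.
  move=> n m /sC; rewrite rnorm_le ?(ltW (r_gt0 _))//.
  by have := rinner_ge0 ((s m).1 - (s n).1); lra.
exists u, v; split=> [e /small [n rn]|q Gq].
  by exists (s n); split; rewrite ?(le_lt_trans _ rn).
apply/eqP; rewrite -subr_eq0 -normr_le0.
pose c := rnorm q.1 + rnorm q.2 + (rinner q.1 q.1 + rinner q.2 q.2 + 1).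
apply: (@le_inv_succ _ c) => n; rewrite -/(r n).
have g1 := le_trans (CauchySchwarz_rinner (u - (s n).1) q.1)
  (ler_wpM2r (rnorm_ge0 q.1) (uP n)).
have g2 := le_trans (CauchySchwarz_rinner (v - (s n).2) q.2)
  (ler_wpM2r (rnorm_ge0 q.2) (vP n)).
pose g := rinner (x - (s n).1) q.1 - rinner (s n).2 q.2.
(* Moving [s n] by t q cannot bring [f] below [d]. Taking t = r n and t = - r n then bounds |g| by a
   multiple of [r n]. *)
have key (t : R) : 2 * t * g <=
    t ^+ 2 * (rinner q.1 q.1 + rinner q.2 q.2) + r n ^+ 2 / 4.
  have := df _ (GD t _ _ (sG n) Gq); have := sf n.
  rewrite /f /g /=; case: (s n) => a b /=.
  rewrite !rinnerE (rinnerC a x) (rinnerC q.1) (rinnerC q.1 a) (rinnerC q.2 b).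
  by rewrite expr2; lra.
have key1 : `|g| <= r n * (rinner q.1 q.1 + rinner q.2 q.2 + 1).
  have := key (r n); have := key (- r n).
  have := rinner_ge0 q.1; have := rinner_ge0 q.2.
  have := r_gt0 n; clear key.
  move: (r n) (g) (rinner q.1 _) (rinner q.2 _) => a g' A B a0 B0 A0.
  rewrite sqrrN => k1 k2.
  have h (z : R) : 2 * a * z <= a ^+ 2 * (A + B) + a ^+ 2 / 4 -> z <= a * (A + B + 1).
    move=> hz; rewrite -(@ler_pM2l _ (2 * a)) ?mulr_gt0 ?ltr0n//.
    apply: (le_trans hz); rewrite -subr_ge0.
    have -> : 2 * a * (a * (A + B + 1)) - (a ^+ 2 * (A + B) + a ^+ 2 / 4) =
      a ^+ 2 * (A + B + (1 + 3 / 4)) by field.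
    by rewrite mulr_ge0 ?sqr_ge0//; lra.
  rewrite ler_norml; apply/andP; split; last exact: h.
  by rewrite lerNl; apply: h; lra.
have -> : rinner (x - u) q.1 - rinner v q.2 = g + (- rinner (u - (s n).1) q.1)
    + rinner (v - (s n).2) q.2 * -1.
  by rewrite /g !rinnerE; ring.
apply: (le_trans (ler_normD _ _)); rewrite normrM normrN1 mulr1.
apply: (le_trans (lerD (ler_normD _ _) (lexx _))); rewrite normrN /c.
by move: g1 g2 key1; lra.
Qed.

(** Projecting (x, 0) on the closure of D × {0} leaves a remainder orthogonal to [D], hence zero. *)
Lemma total_dense (D : set H) : D 0 ->
  (forall (r : R) x y, D x -> D y -> D (x + r%:C *: y)) ->
  (forall x, (forall w, D w -> rinner x w = 0) -> x = 0) -> dense D.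
Proof.
move=> D0 DD Dt; apply/dense_rnorm => x e e0.
have [|u [v [nuv uvP]]] := @projection [set p | D p.1 /\ p.2 = 0] x.
  split=> // r p q /= [Dp p0] [Dq q0]; split; first exact: DD.
  by rewrite p0 q0 scaler0 addr0.
have /eqP : x - u = 0.
  by apply: Dt => w Dw; rewrite (uvP (w, 0))//= rinner0r.
rewrite subr_eq0 => /eqP ->.
by have [[w w'] [/= [Dw _] uw _]] := nuv e e0; exists w.
Qed.

End Topology.

(** * Square roots of bounded operators *)

Section BoundedSqrt.
Variables (R : realType) (H : hilbertType R).
Implicit Types (f g X Y Z : H -> H) (x y z : H).

Definition rlinear f := forall (r : R) x y, f (x + r%:C *: y) = f x + r%:C *: f y.

Definition bounded_map f :=
  exists2 k : R, 0 <= k & forall x, rnorm (f x) <= k * rnorm x.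

Definition symmetric_map f := forall x y, rinner (f x) y = rinner x (f y).

Definition positive_map f := forall x, 0 <= rinner (f x) x.

Definition commuting f g := forall x, f (g x) = g (f x).

(** Moving [f] to the other side of the product reduces its linearity to that of the product. *)
Lemma symmetric_rlinear f : symmetric_map f -> rlinear f.
Proof. by move=> sf r x y; apply: rinner_inj => z; rewrite sf !rinnerE !sf. Qed.

Lemma rlinearD f x y : rlinear f -> f (x + y) = f x + f y.
Proof. move=> fl; have e z : z = 1%:C *: z :> H by rewrite rmorph1 scale1r.
by rewrite [in LHS](e y) fl -e. Qed.

Lemma rlinear0 f : rlinear f -> f 0 = 0.
Proof.
by move=> fl; apply: (@addrI _ (f 0)); rewrite -rlinearD// !addr0.
Qed.

Lemma rlinearZ f (r : R) x : rlinear f -> f (r%:C *: x) = r%:C *: f x.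
Proof. by move=> fl; rewrite -[_ *: x]add0r fl rlinear0// add0r. Qed.

Lemma rlinearN f x : rlinear f -> f (- x) = - f x.
Proof.
by move=> fl; apply: (@addrI _ (f x)); rewrite -rlinearD// !subrr rlinear0.
Qed.

Lemma rlinearB f x y : rlinear f -> f (x - y) = f x - f y.
Proof. by move=> fl; rewrite rlinearD// rlinearN. Qed.

(** * Iteration for 1 - (1 - X)^(1/2) *)

Section Iteration.
Variable X : H -> H.
Hypotheses (symX : symmetric_map X) (X1 : forall x, rnorm (X x) <= rnorm x).

(** A fixed point Y satisfies X + Y^2 = 2 Y, that is (1 - Y)^2 = 1 - X. *)
Fixpoint sqrt_iter n : H -> H := if n is m.+1 then
  fun x => 2^-1%:C *: (X x + sqrt_iter m (sqrt_iter m x)) else fun=> 0.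

(** The same recursion with X replaced by the number 1; its increments dominate those of [sqrt_iter]
    in norm. *)
Fixpoint sqrt_coef n : R := if n is m.+1 then
  (1 + sqrt_coef m ^+ 2) / 2 else 0.

Local Notation s := sqrt_iter.
Local Notation c := sqrt_coef.

Lemma sqrt_iter_sym n : symmetric_map (s n).
Proof.
elim: n => [|n IH] x y; first by rewrite !rinnerE.
by rewrite /= !rinnerE symX !IH.
Qed.

Lemma sqrt_iter_lin n : rlinear (s n).
Proof. exact/symmetric_rlinear/sqrt_iter_sym. Qed.

Lemma sqrt_iter_commute n Z : rlinear Z -> commuting Z X -> commuting Z (s n).
Proof.
move=> lZ ZX; elim: n => [|n IH] x /=; first exact: rlinear0.
by rewrite rlinearZ// rlinearD// ZX !IH.
Qed.

Lemma sqrt_iterC m n : commuting (s m) (s n).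
Proof.
apply: sqrt_iter_commute => [|x]; first exact: sqrt_iter_lin.
by apply/esym/sqrt_iter_commute => //; exact: symmetric_rlinear.
Qed.

Lemma sqrt_coef_bound n : 0 <= c n /\ c n <= 1.
Proof.
elim: n => [|n [IH0 IH1]] /=; first by rewrite lexx ler01.
have : c n ^+ 2 <= 1 by rewrite expr_le1.
by have := sqr_ge0 (c n); lra.
Qed.

(** The gap t = 1 - c n evolves by t - t^2 / 2. The induction uses the sharper bound 2 / (n + 2),
    which stays at most 1, where this function is increasing. *)
Lemma sqrt_coef_rate n : 1 - c n <= 2 * n.+1%:R^-1.
Proof.
suff {n} h n : 1 - c n <= 2 * n.+2%:R^-1.
  by apply: le_trans (h n) _; rewrite ler_pM2l// lef_pV2 ?posrE ?ltr0n// ler_nat.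
elim: n => [|n IH]; first by rewrite /= subr0 divff// pnatr_eq0.
have [c0 c1] := sqrt_coef_bound n.
have n0 : 0 <= n%:R :> R by rewrite ler0n.
set t := 1 - c n in IH.
have -> : 1 - c n.+1 = t - t ^+ 2 / 2 by rewrite /= /t; field.
have t1 : t <= 1 by rewrite /t; lra.
have t0 : 0 <= t by rewrite /t; lra.
have p0 : 0 < n%:R + 2 :> R by lra.
have q1 : 2 * n.+2%:R^-1 <= 1 :> R.
  by rewrite ler_pdivrMr ?ltr0n// mul1r ler_nat.
set w := 2 * n.+2%:R^-1 in IH q1.
have wt : t - t ^+ 2 / 2 <= w - w ^+ 2 / 2.
  rewrite -subr_ge0.
  have -> : w - w ^+ 2 / 2 - (t - t ^+ 2 / 2) = (w - t) * (1 - (w + t) / 2) by field.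
  by rewrite mulr_ge0//; lra.
apply: le_trans wt _; rewrite /w -[n.+3]addn3 -[n.+2]addn2 !natrD.
rewrite -subr_ge0.
have -> : 2 * (n%:R + 3)^-1 - (2 * (n%:R + 2)^-1 - (2 * (n%:R + 2)^-1) ^+ 2 / 2)
  = 2 / ((n%:R + 3) * (n%:R + 2) ^+ 2) :> R by field; apply/andP; split; lra.
by rewrite divr_ge0// mulr_ge0 ?sqr_ge0//; lra.
Qed.

Lemma sqrt_iter_bound n x : rnorm (s n x) <= c n * rnorm x.
Proof.
elim: n x => [|n IH] x /=; first by rewrite /rnorm rinner0l sqrtr0 mul0r.
have [c0 _] := sqrt_coef_bound n.
rewrite rnormZ ger0_norm ?invr_ge0// mulrAC mulrC ler_pM2r ?invr_gt0//.
apply: le_trans (rnormD _ _) _; rewrite mulrDl mul1r lerD//.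
by apply: le_trans (IH _) _; rewrite expr2 -mulrA ler_wpM2l.
Qed.

(** Since the iterates commute, the difference of their squares factors as (s n.+1 + s n) (s n.+1 -
    s n); the coefficients factor in the same way. *)
Lemma sqrt_iter_step n x :
  rnorm (s n.+1 x - s n x) <= (c n.+1 - c n) * rnorm x.
Proof.
elim: n x => [|n IH] x.
  by rewrite !subr0; exact: sqrt_iter_bound 1%N x.
have -> : s n.+2 x - s n.+1 x = 2^-1%:C *:
    (s n.+1 (s n.+1 x - s n x) + s n (s n.+1 x - s n x)).
  rewrite !(rlinearB _ _ (@sqrt_iter_lin _)) (sqrt_iterC n n.+1).
  by apply: rinner_inj => z; rewrite /= !rinnerE; ring.
have -> : c n.+2 - c n.+1 = (c n.+1 + c n) * (c n.+1 - c n) / 2.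
  by rewrite /=; field.
rewrite rnormZ ger0_norm ?invr_ge0// mulrAC [X in _ <= X]mulrC.
rewrite ler_pM2l ?invr_gt0// -mulrA mulrDl.
have [c0 _] := sqrt_coef_bound n; have [c10 _] := sqrt_coef_bound n.+1.
apply: le_trans (rnormD _ _) (lerD _ _).
  by apply: le_trans (sqrt_iter_bound _ _) _; rewrite ler_wpM2l.
by apply: le_trans (sqrt_iter_bound _ _) _; rewrite ler_wpM2l.
Qed.

Lemma sqrt_iter_cauchy n m x : (n <= m)%N ->
  rnorm (s m x - s n x) <= (1 - c n) * rnorm x.
Proof.
move=> /subnKC <-; move: (m - n)%N => {}m.
suff h : rnorm (s (n + m) x - s n x) <= (c (n + m)%N - c n) * rnorm x.
  apply: le_trans h _; rewrite ler_wpM2r ?rnorm_ge0// lerB//.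
  by case: (sqrt_coef_bound (n + m)%N).
elim: m => [|m IH]; first by rewrite addn0 !subrr /rnorm rinner0l sqrtr0 mul0r.
rewrite addnS; have := sqrt_iter_step (n + m) x.
have := rnormD (s (n + m).+1 x - s (n + m) x) (s (n + m) x - s n x).
by rewrite addrA subrK; move: IH; lra.
Qed.

Lemma sqrt_iter_lim : exists Y, forall n x,
  rnorm (Y x - s n x) <= 2 * rnorm x * n.+1%:R^-1.
Proof.
suff h x : exists l, forall n, rnorm (l - s n x) <= 2 * rnorm x * n.+1%:R^-1.
  by exists (fun x => projT1 (cid (h x))) => n x; case: cid => l /= ->.
apply: cauchy_rnorm => [n m nm|e e0].
  apply: le_trans (sqrt_iter_cauchy x nm) _.
  by rewrite mulrAC ler_wpM2r ?rnorm_ge0// sqrt_coef_rate.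
have k0 : 0 < 2 * rnorm x + 1 by have := rnorm_ge0 x; lra.
have [n nle] := inv_succ_small (divr_gt0 e0 k0).
exists n; move: nle; rewrite ltr_pdivlMr//; apply: le_lt_trans.
by rewrite mulrC ler_pM2l ?inv_succ_gt0//; lra.
Qed.

(** Y is 1 - (1 - X)^(1/2). Each property passes to the limit from [sqrt_iter], with an error of
    order 1 / (n + 1). *)
Lemma one_sub_sqrt : exists Y, [/\ symmetric_map Y, forall x, rnorm (Y x) <= rnorm x,
  forall x, X x + Y (Y x) = 2%:C *: Y x &
  forall Z, rlinear Z -> bounded_map Z -> commuting Z X -> commuting Z Y].
Proof.
have [Y YP] := sqrt_iter_lim; exists Y.
have sn1 n x : rnorm (s n x) <= rnorm x.
  apply: le_trans (sqrt_iter_bound _ _) _.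
  by rewrite ler_piMl ?rnorm_ge0//; case: (sqrt_coef_bound n).
split.
- move=> x y; apply/eqP; rewrite -subr_eq0 -normr_le0.
  apply: (@le_inv_succ _ _ (4 * rnorm x * rnorm y)) => n.
  have -> : rinner (Y x) y - rinner x (Y y) =
      rinner (Y x - s n x) y - rinner x (Y y - s n y).
    by rewrite !rinnerE sqrt_iter_sym; ring.
  apply: le_trans (ler_normB _ _) _.
  apply: le_trans (lerD (CauchySchwarz_rinner _ _) (CauchySchwarz_rinner _ _)) _.
  have h1 := ler_wpM2r (rnorm_ge0 y) (YP n x).
  have h2 := ler_wpM2l (rnorm_ge0 x) (YP n y).
  by move: (n.+1%:R^-1) h1 h2 => i; lra.
- move=> x; rewrite -subr_le0.
  apply: (@le_inv_succ _ _ (2 * rnorm x)) => n.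
  have := rnormD (Y x - s n x) (s n x); rewrite subrK.
  by have := sn1 n x; move: (n.+1%:R^-1) (YP n x) => i; lra.
- move=> x; apply/eqP; rewrite -subr_eq0; apply/eqP/rnorm_eq0.
  apply: (@le_inv_succ _ _ (2 * rnorm (Y x) + 6 * rnorm x)) => n.
  (* X is replaced by 2 s n.+1 - (s n)^2, so that each term contains the difference of Y and an
     iterate. *)
  have -> : X x + Y (Y x) - 2%:C *: Y x = (Y (Y x) - s n (Y x)) +
      (s n (Y x - s n x) - 2%:C *: (Y x - s n.+1 x)).
    rewrite (rlinearB _ _ (@sqrt_iter_lin _)).
    by apply: rinner_inj => z; rewrite /= !rinnerE; field.
  apply: le_trans (rnormD _ _) _.
  apply: le_trans (lerD (YP _ _) (rnormD _ _)) _.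
  rewrite rnormN rnormZ ger0_norm//.
  have h1 := le_trans (sn1 n _) (YP n x).
  have h2 := YP n.+1 x.
  have h3 : 2 * rnorm x * n.+2%:R^-1 <= 2 * rnorm x * n.+1%:R^-1.
    rewrite ler_wpM2l ?mulr_ge0 ?rnorm_ge0//.
    by rewrite lef_pV2 ?posrE ?ltr0n// ler_nat.
  by move: (n.+1%:R^-1) (n.+2%:R^-1) h1 h2 h3 => i j; lra.
- move=> Z lZ [k k0 Zk] ZX x.
  apply/eqP; rewrite -subr_eq0; apply/eqP/rnorm_eq0.
  apply: (@le_inv_succ _ _ (4 * k * rnorm x)) => n.
  have -> : Z (Y x) - Y (Z x) = Z (Y x - s n x) - (Y (Z x) - s n (Z x)).
    rewrite rlinearB// sqrt_iter_commute//.
    by rewrite opprB addrA subrK.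
  apply: le_trans (rnormD _ _) _; rewrite rnormN.
  have h1 := le_trans (Zk _) (ler_wpM2l k0 (YP n x)).
  have h2 := YP n (Z x).
  have i0 := inv_succ_gt0 R n.
  have h3 := ler_wpM2r (ltW i0) (Zk x).
  by move: (n.+1%:R^-1) h1 h2 h3 => i; lra.
Qed.

End Iteration.

(** With X = 1 - P the root is C = 1 - Y, positive because |Y x| <= |x|. Commutation is stated for
    real-linear Z so as to cover multiplication by i and antiunitary maps. *)
Lemma bounded_sqrt P : symmetric_map P ->
  (forall x, rnorm (x - P x) <= rnorm x) ->
  exists C, [/\ symmetric_map C, forall x, rnorm (x - C x) <= rnorm x, positive_map C,
    forall x, C (C x) = P x &
    forall Z, rlinear Z -> bounded_map Z -> commuting Z P -> commuting Z C].
Proof.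
move=> sP P1.
have [|Y [sY Y1 YE Ycom]] := @one_sub_sqrt (fun x => x - P x) _ P1.
  by move=> x y; rewrite !rinnerE sP.
have lY := symmetric_rlinear sY.
exists (fun x => x - Y x); split.
- by move=> x y; rewrite !rinnerE sY.
- by move=> x; rewrite opprB addrC subrK.
- move=> x; rewrite !rinnerE subr_ge0 -sqr_rnorm expr2.
  apply: le_trans (ler_norm _) _; apply: le_trans (CauchySchwarz_rinner _ _) _.
  by rewrite ler_wpM2r ?rnorm_ge0.
- move=> x; rewrite rlinearB//; apply: rinner_inj => z.
  have /(congr1 (fun u => rinner u z)) := YE x.
  by rewrite !rinnerE; lra.
- move=> Z lZ bZ ZP x; rewrite rlinearB// Ycom// => y.
  by rewrite rlinearB// ZP.
Qed.

End BoundedSqrt.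

(** * Resolvents and square roots of unbounded operators *)

Section Resolvent.
Variables (R : realType) (H : hilbertType R).
Implicit Types (T S N : operator H) (B C D Z : H -> H) (x y z u v w : H).

Lemma op_mulP (A T : operator H) x y :
  (A * T)%op x = Some y <-> exists2 u, T x = Some u & A u = Some y.
Proof.
rewrite /op_mul; case: (T x) => [u|] /=; last by split=> // -[].
by split=> [Au|[_ [<-]]//]; exists u.
Qed.

Lemma op_ext T S : (forall x y, T x = Some y <-> S x = Some y) -> T = S.
Proof.
move=> TS; apply/funext => x; case Tx: (T x) => [y|]; first exact/esym/TS.
by case Sx: (S x) => [y|//]; move/TS: Sx; rewrite Tx.
Qed.

Lemma some_eltP (X : Type) (P : set X) (u : X) : is_subset1 P ->
  some_elt P = Some u <-> P u.
Proof.
move=> P1; rewrite /some_elt; case: pselect => [h|h]; last first.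
  by split=> // Pu; exfalso; apply: h; exists u.
case: cid => v Pv /=; split=> [[<-]//|Pu]; congr Some; exact: P1.
Qed.

Definition rlinear_op T := T 0 = Some 0 /\ forall (r : R) x y u v,
  T x = Some u -> T y = Some v -> T (x + r%:C *: y) = Some (u + r%:C *: v).

Definition radjoint T y u := forall x v, T x = Some v -> rinner v y = rinner x u.

Lemma linear_rlinear_op T : linear_op T -> rlinear_op T.
Proof.
by move=> [T0 TD]; split=> // r x y u v /(TD 1 r%:C _ _ _ _)/[apply]; rewrite !scale1r.
Qed.

Lemma antilinear_rlinear_op T : antilinear_op T -> rlinear_op T.
Proof.
move=> [T0 TD]; split=> // r x y u v /(TD 1 r%:C _ _ _ _)/[apply].
by rewrite conjC1 !scale1r => ->; rewrite [Num.conj _]conjc_real.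
Qed.

Lemma linear_op_i T x u : linear_op T -> T x = Some u ->
  T ('i *: x) = Some ('i *: u).
Proof. by move=> [T0 TD] /(TD 'i 0)/(_ T0); rewrite !scale0r !addr0. Qed.

Lemma antilinear_op_i T x u : antilinear_op T -> T x = Some u ->
  T ('i *: x) = Some (- ('i *: u)).
Proof.
move=> [T0 TD] /(TD 'i 0)/(_ T0); rewrite !scaler0 !addr0 => ->.
by rewrite -scaleNr; congr (Some (_ *: _)); rewrite [Num.conj _]/=; simpc.
Qed.

Lemma radjoint_unique T y : densely_defined T -> is_subset1 (radjoint T y).
Proof.
move=> dT u u' hu hu'; apply/eqP; rewrite -subr_eq0; apply/eqP.
apply: (dense_total dT) => x; rewrite /dom /=; case Tx: (T x) => [v|//] _.
by rewrite !rinnerE !(rinnerC _ x) -(hu _ _ Tx) -(hu' _ _ Tx) subrr.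
Qed.

(** The imaginary part of the complex identity at x is, up to sign, its real part at i x. *)
Lemma linear_adjP T y u : linear_op T -> densely_defined T ->
  linear_adj T y = Some u <-> radjoint T y u.
Proof.
move=> lT dT; rewrite /linear_adj.
have -> : [set u | forall x v, T x = Some v -> ⟨v, y⟩ = ⟨x, u⟩] = radjoint T y.
  apply/seteqP; split=> [{}u /= uP x v Tx|{}u /= uP x v Tx].
    by rewrite /rinner (uP _ _ Tx).
  rewrite !inner_rinner (uP _ _ Tx) -[rinner v _]opprK -rinneriC.
  by rewrite (uP _ _ (linear_op_i lT Tx)) rinneriC opprK.
by apply: some_eltP; exact: radjoint_unique.
Qed.

(** As in the linear case; the sign in T (i x) = - i T x is absorbed by the exchanged order in ⟨u,
    x⟩. *)
Lemma antilinear_adjP T y u : antilinear_op T -> densely_defined T ->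
  (T^†)%op y = Some u <-> radjoint T y u.
Proof.
move=> lT dT; rewrite /antilinear_adj.
have -> : [set u | forall x v, T x = Some v -> ⟨v, y⟩ = ⟨u, x⟩] = radjoint T y.
  apply/seteqP; split=> [{}u /= uP x v Tx|{}u /= uP x v Tx].
    by rewrite /rinner (uP _ _ Tx) -/(rinner _ _) rinnerC.
  rewrite !inner_rinner (uP _ _ Tx) [rinner u x]rinnerC -[rinner v _]opprK.
  rewrite -rinneriC -rinnerNl (uP _ _ (antilinear_op_i lT Tx)).
  by rewrite [rinner u _]rinnerC.
by apply: some_eltP; exact: radjoint_unique.
Qed.

(* For T' = T^†, a map B with [resolvent T T' B] is (1 + T^† T)^-1. *)
Definition dual_pair T T' := [/\ rlinear_op T, rlinear_op T' &
  forall x u y v, T x = Some u -> T' y = Some v -> rinner u y = rinner x v].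

Definition resolvent T T' B := forall x,
  exists2 u, T (B x) = Some u & T' u = Some (x - B x).

(** The everywhere defined map T B. Under [resolvent T T' B] the default 0 is never taken. *)
Definition op_fun T B x := odflt 0 (T (B x)).

Lemma dual_pairC T T' : dual_pair T T' -> dual_pair T' T.
Proof.
case=> lT lT' TT'; split=> // x u y v xu yv.
by rewrite rinnerC -(TT' _ _ _ _ yv xu) rinnerC.
Qed.

Lemma rlinear_opB T x y u v : rlinear_op T -> T x = Some u -> T y = Some v ->
  T (x - y) = Some (u - v).
Proof.
move=> lT Tx Ty; have := lT.2 (-1) _ _ _ _ Tx Ty.
by rewrite rmorphN1 !scaleN1r.
Qed.

(** * Symmetry and bounds of the resolvent *)

Section ResolventTheory.
Variables (T T' : operator H) (B : H -> H).
Hypotheses (dTT' : dual_pair T T') (rB : resolvent T T' B).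

Local Notation N := (op_fun T B).

Lemma op_funE x : T (B x) = Some (N x).
Proof. by rewrite /op_fun; case: (rB x) => u ->. Qed.

Lemma op_fun_adj x : T' (N x) = Some (x - B x).
Proof. by rewrite /op_fun; case: (rB x) => u -> /= ->. Qed.

(** 1 + T' T is injective: the difference d of two solutions satisfies T' T d = - d, hence |T d|^2 =
    - |d|^2. *)
Lemma resolvent_unique x u w : T x = Some u -> T' u = Some w -> B (x + w) = x.
Proof.
move=> Tx T'u; have [lT lT' TT'] := dTT'; set z := x + w.
have h1 := rlinear_opB lT (op_funE z) Tx.
have h2 := rlinear_opB lT' (op_fun_adj z) T'u.
have := TT' _ _ _ _ h1 h2.
have -> : z - B z - w = - (B z - x).
  by rewrite /z; apply: rinner_inj => t; rewrite !rinnerE; ring.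
rewrite rinnerNr => h.
apply/eqP; rewrite -subr_eq0; apply/eqP/rinner_eq0.
have := rinner_ge0 (N z - u); have := rinner_ge0 (B z - x); lra.
Qed.

Lemma rinner_op_fun x y : rinner (N x) (N y) = rinner (x - B x) (B y).
Proof.
have [_ _ TT'] := dTT'.
by rewrite rinnerC (TT' _ _ _ _ (op_funE y) (op_fun_adj x)) rinnerC.
Qed.

(** The left side of [rinner_op_fun] is symmetric in x and y, and so is the term ⟨B x, B y⟩ on the
    right. *)
Lemma resolvent_sym : symmetric_map B.
Proof.
move=> x y; have := rinner_op_fun x y; have := rinner_op_fun y x.
rewrite rinnerC => ->; rewrite !rinnerE (rinnerC y) (rinnerC (B y) (B x)); lra.
Qed.

Lemma resolvent_lin : rlinear B.
Proof. exact/symmetric_rlinear/resolvent_sym. Qed.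

Lemma op_fun_lin : rlinear N.
Proof.
move=> r x y; have [lT _ _] := dTT'.
by have := lT.2 r _ _ _ _ (op_funE x) (op_funE y); rewrite -resolvent_lin op_funE => -[].
Qed.

Lemma resolvent_le x : rnorm (B x) <= rnorm x.
Proof.
rewrite ler_rnorm; have := rinner_op_fun x x; have := rinner_ge0 (N x).
have := rinner_ge0 (x - B x); rewrite !rinnerE (rinnerC (B x) x); lra.
Qed.

Lemma one_sub_resolvent_le x : rnorm (x - B x) <= rnorm x.
Proof.
rewrite ler_rnorm; have := rinner_op_fun x x; have := rinner_ge0 (N x).
have := rinner_ge0 (B x); rewrite !rinnerE (rinnerC (B x) x); lra.
Qed.

Lemma op_fun_le x : rnorm (N x) <= rnorm x.
Proof.
rewrite ler_rnorm rinner_op_fun -sqr_rnorm expr2.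
apply: le_trans (ler_norm _) (le_trans (CauchySchwarz_rinner _ _) _).
by rewrite ler_pM ?rnorm_ge0 ?resolvent_le ?one_sub_resolvent_le.
Qed.

Lemma resolvent_inj x : B x = 0 -> x = 0.
Proof.
move=> Bx; have [lT lT' _] := dTT'.
have := op_fun_adj x; have := op_funE x; rewrite Bx lT.1 => -[<-].
by rewrite lT'.1 subr0 => -[].
Qed.

(** Both sides describe the kernel of [T]. The right one involves [B] alone, so operators sharing
    [B] share their kernel. *)
Lemma op_fun_ker x : N x = 0 <-> B x = x.
Proof.
have [_ lT' _] := dTT'; split=> [Nx|Bx].
  have := op_fun_adj x; rewrite Nx lT'.1 => -[/esym/eqP].
  by rewrite subr_eq0 => /eqP.
by apply: rinner_eq0; rewrite rinner_op_fun Bx subrr rinner0l.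
Qed.

End ResolventTheory.

(** * Pairs for which B inverts both 1 + T' T and 1 + T T' *)

Section NormalPair.
Variables (T T' : operator H) (B : H -> H).
Hypotheses (dTT' : dual_pair T T') (rB : resolvent T T' B)
  (rB' : resolvent T' T B).

(** If T x = y, then T T' (T B x) = T (x - B x) = y - T B x, so [B] sends y to T B x. Conversely T'
    (B y) = x - B x, and applying T gives T (x - B x) = y - B y. *)
Lemma normal_graph x y : T x = Some y <-> op_fun T B x = B y.
Proof.
have [lT lT' _] := dTT'; split=> [Tx|NxBy].
  have := rlinear_opB lT Tx (op_funE rB x).
  move/(resolvent_unique (dual_pairC dTT') rB' (op_fun_adj rB x)).
  by rewrite addrC subrK.
have TBy : T (B x) = Some (B y) by rewrite (op_funE rB) NxBy.
have T'By : T' (B y) = Some (x - B x) by rewrite -NxBy (op_fun_adj rB).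
have Tx : T (x - B x) = Some (y - B y).
  by have [u] := rB' y; rewrite T'By => -[<-].
by have := lT.2 1 _ _ _ _ Tx TBy; rewrite rmorph1 !scale1r !subrK.
Qed.

Lemma op_funC : commuting (op_fun T B) B.
Proof. by move=> x; apply/normal_graph/(op_funE rB). Qed.

(** Writing y = B y + T T' B y, each summand is paired with T B x through the duality of [T] and
    [T']. *)
Lemma rinner_op_funl x y :
  rinner (op_fun T B x) y = rinner x (op_fun T' B y).
Proof.
have [_ _ TT'] := dTT'.
have e1 := TT' _ _ _ _ (op_funE rB x) (op_funE rB' y).
have e2 := TT' _ _ _ _ (op_fun_adj rB' y) (op_fun_adj rB x).
move: e1 e2; rewrite !rinnerE (rinnerC y) (rinnerC (B y)) (rinnerC _ x).
by rewrite (rinnerC _ (B x)); lra.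
Qed.

End NormalPair.

Lemma commutingC (f g : H -> H) : commuting f g -> commuting g f.
Proof. by move=> fg x; rewrite fg. Qed.

(* With C = B^(1/2) and D = (1 - B)^(1/2), D C^-1 is the root of B^-1 - 1. *)
Definition root_pair B C D := [/\ symmetric_map C, symmetric_map D,
  (forall x, C (C x) = B x) /\ (forall x, D (D x) = x - B x), commuting C D &
  (forall x, 0 <= rinner (C (D x)) x) /\
  (forall x, rinner (C (D x)) x = 0 -> C (D x) = 0)] /\
  forall Z, rlinear Z -> bounded_map Z -> commuting Z B ->
    commuting Z C /\ commuting Z D.

Lemma bounded_le Z : (forall x, rnorm (Z x) <= rnorm x) -> bounded_map Z.
Proof. by move=> Z1; exists 1 => // x; rewrite mul1r. Qed.

Lemma bounded_sub_le Z : (forall x, rnorm (x - Z x) <= rnorm x) -> bounded_map Z.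
Proof.
move=> Z1; exists 2 => // x; have := rnormD x (- (x - Z x)).
by rewrite opprB addrC subrK rnormB; have := Z1 x; lra.
Qed.

Lemma exists_root_pair B : symmetric_map B -> (forall x, rnorm (B x) <= rnorm x) ->
  (forall x, rnorm (x - B x) <= rnorm x) -> exists C D, root_pair B C D.
Proof.
move=> sB B1 B1'; have lB := symmetric_rlinear sB.
have [C [sC C1 pC CC Ccom]] := bounded_sqrt sB B1'.
have [| |D [sD D1 pD DD Dcom]] := @bounded_sqrt _ _ (fun x => x - B x).
- by move=> x y; rewrite !rinnerE sB.
- by move=> x; rewrite opprB addrC subrK.
have ZD Z : rlinear Z -> bounded_map Z -> commuting Z B -> commuting Z D.
  by move=> lZ bZ ZB; apply: Dcom => // x; rewrite rlinearB// ZB.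
have BC : commuting B C by apply: Ccom => //; exact: bounded_le.
have lC := symmetric_rlinear sC; have lD := symmetric_rlinear sD.
have CD : commuting C D := ZD _ lC (bounded_sub_le C1) (commutingC BC).
(* Second roots F = C^(1/2) and K = D^(1/2) turn ⟨C D x, x⟩ into |K F x|^2, which gives both
   positivity and its equality case. *)
have [F [sF F1 _ FF Fcom]] := bounded_sqrt sC C1.
have [K [sK _ _ KK _]] := bounded_sqrt sD D1.
have DF : commuting D F := Fcom _ lD (bounded_sub_le D1) (commutingC CD).
have CDF x : rinner (C (D x)) x = rinner (K (F x)) (K (F x)).
  by rewrite -FF sF -DF -KK sK.
exists C, D; split; last by split; [exact: Ccom|exact: ZD].
split=> //; split=> x; rewrite CDF ?rinner_ge0// => /rinner_eq0 KF0.
by rewrite -FF -DF -KK KF0 !rlinear0//; exact: symmetric_rlinear.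
Qed.

(** * The unbounded square root of B^-1 - 1 *)

Section RootPair.
Variables (B C D : H -> H).
Hypotheses (CDP : root_pair B C D) (injB : forall x, B x = 0 -> x = 0).

Let sC : symmetric_map C. Proof. by case: CDP => -[]. Qed.
Let sD : symmetric_map D. Proof. by case: CDP => -[]. Qed.
Let CC x : C (C x) = B x. Proof. by case: CDP => -[_ _ []]. Qed.
Let DD x : D (D x) = x - B x. Proof. by case: CDP => -[_ _ []]. Qed.
Let CD x : C (D x) = D (C x). Proof. by case: CDP => -[_ _ _ ->]. Qed.
Let lC : rlinear C. Proof. exact: symmetric_rlinear. Qed.
Let lD : rlinear D. Proof. exact: symmetric_rlinear. Qed.

Lemma root_pair_inj x : C x = 0 -> x = 0.
Proof. by move=> Cx; apply: injB; rewrite -CC Cx rlinear0. Qed.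

(** The operator C^-1 D, written without an inverse. *)
Definition root_op : operator H := fun x => some_elt [set y | D x = C y].

Lemma root_opP x y : root_op x = Some y <-> D x = C y.
Proof.
apply: (@some_eltP _ [set y | D x = C y]) => u v /= -> Cuv.
apply/eqP; rewrite -subr_eq0; apply/eqP/root_pair_inj.
by rewrite rlinearB// Cuv subrr.
Qed.

Lemma root_op_image z : root_op (C z) = Some (D z).
Proof. by apply/root_opP; rewrite CD. Qed.

(** The witness z = C x + D y works because C^2 + D^2 = 1. *)
Lemma root_op_image_inv x y : root_op x = Some y ->
  exists z, x = C z /\ y = D z.
Proof.
move/root_opP => DC; exists (C x + D y); split.
  by rewrite rlinearD// CC CD -DC DD addrC subrK.
by rewrite rlinearD// DD -CD DC CC addrC subrK.
Qed.

(** Tested on the graph points (C z, D z), the adjoint relation reads ⟨z, D y⟩ = ⟨z, C u⟩. *)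
Lemma radjoint_root y u : radjoint root_op y u <-> root_op y = Some u.
Proof.
split=> [h|yu].
  apply/root_opP/rinner_inj => z; have := h _ _ (root_op_image z).
  by rewrite sD sC rinnerC => ->; rewrite rinnerC.
move=> x v /root_op_image_inv[z [-> ->]].
by move/root_opP: yu => yu; rewrite sD yu sC.
Qed.

Lemma root_op_sq x y : (root_op * root_op)%op x = Some y <-> B (x + y) = x.
Proof.
split=> [/op_mulP[w /root_opP xw /root_opP wy]|xy].
  by rewrite -CC !rlinearD// -wy CD -xw DD CC addrC subrK.
(* As x = C^2 (x + y), the intermediate value C^-1 D x is D C (x + y). *)
apply/op_mulP; exists (C (D (x + y))).
  have e : x = C (C (x + y)) by rewrite CC xy.
  by apply/root_opP; rewrite [in LHS]e -!CD.
apply/root_opP; rewrite -CD; congr (C _).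
by rewrite DD xy addrC addKr.
Qed.

Hypothesis iB : commuting ( *:%R 'i) B.

Let i_lin : rlinear ( *:%R 'i : H -> H).
Proof. by move=> r x y; rewrite scalerDr !scalerA mulrC. Qed.

Let i_bounded : bounded_map ( *:%R 'i : H -> H).
Proof. by apply: bounded_le => x; rewrite ler_rnorm rinnerii. Qed.

Lemma root_pair_i : commuting ( *:%R 'i) C /\ commuting ( *:%R 'i) D.
Proof. by case: CDP => _; apply. Qed.

Lemma root_op_linear : linear_op root_op.
Proof.
have [iC iD] := root_pair_i.
have clin f : rlinear f -> commuting ( *:%R 'i) f ->
    forall a b x y, f (a *: x + b *: y) = a *: f x + b *: f y.
  move=> lf fi a b x y; rewrite rlinearD// (scaleCE a x) (scaleCE b y).
  by rewrite !(rlinearD _ _ lf) !(rlinearZ _ _ lf) -!fi -!scaleCE.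
split; first by apply/root_opP; rewrite !rlinear0.
move=> a b x y u v /root_opP xu /root_opP yv; apply/root_opP.
by rewrite (clin D)// (clin C)// xu yv.
Qed.

(** The domain contains the range of [C], which is total because [C] is symmetric and injective. *)
Lemma root_op_dense : densely_defined root_op.
Proof.
apply: total_dense => [|r x y|x xP]; rewrite /dom /=.
- by rewrite root_op_linear.1.
- case Ex: (root_op x) => [u|//]; case Ey: (root_op y) => [v|//] _ _.
  by rewrite ((linear_rlinear_op root_op_linear).2 _ _ _ _ _ Ex Ey).
apply/root_pair_inj/rinner_inj => z; rewrite sC rinner0l; apply: xP.
by rewrite /dom /= root_op_image.
Qed.

Lemma root_op_self_adjoint : self_adjoint root_op.
Proof.
split; [exact: root_op_linear|exact: root_op_dense|].
apply: op_ext => x y; rewrite -radjoint_root.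
by apply: linear_adjP; [exact: root_op_linear|exact: root_op_dense].
Qed.

Lemma root_op_positive : positive_op root_op.
Proof.
have [iC iD] := root_pair_i.
move=> x v /root_op_image_inv[z [-> ->]].
have p0 : 0 <= rinner (D z) (C z) by rewrite -sC; case: CDP => -[_ _ _ _ []].
rewrite inner_rinner lecE /= p0 andbT.
(* The imaginary part of ⟨D z, C z⟩ is its own negative: C D is symmetric and commutes with i, while
   i is skew. *)
have e1 : rinner (D z) ('i *: C z) = rinner (C (D z)) ('i *: z).
  by rewrite iC sC.
have e2 : rinner (C (D z)) ('i *: z) = - rinner (C (D z)) ('i *: z).
  rewrite [LHS]sC sD -iC -iD -[LHS]opprK; congr (- _).
  by rewrite -rinneriC -CD rinnerC.
by apply/eqP; rewrite e1; lra.
Qed.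

(* The bounded positive maps C D and op_fun S B have the same square. *)
Lemma root_unique S : dual_pair S S -> resolvent S S B ->
  (forall x v, S x = Some v -> 0 <= rinner v x) ->
  forall x, op_fun S B x = C (D x).
Proof.
move=> dS rS pS x; set M := op_fun S B.
have sM : symmetric_map M by exact: rinner_op_funl.
have lM := symmetric_rlinear sM.
have lB := resolvent_lin dS rS.
have [MC MD] : commuting M C /\ commuting M D.
  case: CDP => _; apply=> //; last exact: (op_funC dS rS rS).
  exact/bounded_le/(op_fun_le dS rS).
have [p0 peq] : (forall x, 0 <= rinner (C (D x)) x) /\
    (forall x, rinner (C (D x)) x = 0 -> C (D x) = 0) by case: CDP => -[].
(* Splitting z = B z + S M z gives ⟨M z, z⟩ = ⟨S B z, B z⟩ + ⟨M z, S M z⟩. *)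
have pM z : 0 <= rinner (M z) z.
  have := pS _ _ (op_funE rS z); have := pS _ _ (op_fun_adj rS z).
  by rewrite -/M rinnerC !rinnerE; lra.
have MM z : M (M z) = B z - B (B z).
  apply: rinner_inj => w; rewrite sM (rinner_op_fun dS rS).
  by rewrite -(resolvent_sym dS rS) rlinearB.
have PP z : C (D (C (D z))) = B z - B (B z).
  by rewrite -CD CC DD rlinearB.
(* Commutation and equality of squares give (C D + M) y = 0. Both forms are nonnegative at y, so C D
   y = M y = 0, and y is orthogonal to itself. *)
set y := C (D x) - M x.
have sumy : C (D y) + M y = 0.
  rewrite /y (rlinearB _ _ lD) (rlinearB _ _ lC) (rlinearB _ _ lM).
  by rewrite PP MM MC MD addrA subrK subrr.
have := p0 y; have := pM y; have := congr1 (fun u => rinner u y) sumy.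
rewrite rinnerDl rinner0l => y1 y2 y3.
have CDy : C (D y) = 0 by apply: peq; lra.
have My : M y = 0 by move: sumy; rewrite CDy add0r.
apply/eqP; rewrite eq_sym -subr_eq0; apply/eqP/rinner_eq0; rewrite -/y.
by rewrite {1}/y rinnerDl rinnerNl sC sD -CD CDy sM My !rinner0r subrr.
Qed.

End RootPair.
End Resolvent.

(** * Isometric extension *)

Section Polar.
Variables (R : realType) (H : hilbertType R).
Implicit Types (T S N : operator H) (B C D V W Z M : H -> H) (x y z u v w : H).

(** Both the relation [matching] below and the graph of T^2 have this form. *)
Lemma closed_rinner_eq (Z : set (H * H)) :
  closed [set q : H * H | forall p, Z p -> rinner q.2 p.2 = rinner q.1 p.1].
Proof.
apply/closed_near_pair => u v near p Zp /=.
apply/eqP; rewrite -subr_eq0 -normr_le0.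
apply: (@le_inv_succ _ _ (rnorm p.1 + rnorm p.2)) => n.
have [q [Gq ltu ltv]] := near _ (inv_succ_gt0 R n).
have -> : rinner v p.2 - rinner u p.1 =
    rinner (v - q.2) p.2 - rinner (u - q.1) p.1.
  by rewrite !rinnerE (Gq _ Zp); ring.
apply: le_trans (ler_normB _ _) _; rewrite mulrC mulrDr addrC.
by apply: lerD; apply: le_trans (CauchySchwarz_rinner _ _) _;
  rewrite ler_wpM2r ?rnorm_ge0 ?ltW.
Qed.

Lemma von_neumann T T' : rlinear_op T -> closed_op T ->
  (forall y u, radjoint T y u -> T' y = Some u) ->
  exists B, resolvent T T' B.
Proof.
move=> [T0 TD] cT T'P.
suff h x : exists b, exists2 u, T b = Some u & T' u = Some (x - b).
  by exists (fun x => projT1 (cid (h x))) => x; case: cid.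
have [|u [v [/(iffLR (closed_near_pair _) cT) Tuv uvP]]] :=
  @projection _ _ (graph T) x.
  by split=> // r p q; apply: TD.
exists u, v; first exact: Tuv.
by apply: T'P => a w Ta; rewrite rinnerC -(uvP (a, w) Ta) rinnerC.
Qed.

(** The weak form of y = V x, for an isometry V with V p.1 = p.2 on [G]. *)
Definition matching (G : set (H * H)) x y :=
  forall p, G p -> rinner y p.2 = rinner x p.1.

(** On the graph of an isometry V, the projection of (x, 0) is (x / 2, V x / 2). So (x, 0) is
    projected on the closed set of matching pairs, and the result is doubled. *)
Lemma matching_exists (G : set (H * H)) x :
  (forall p q, G p -> G q -> rinner p.1 q.1 = rinner p.2 q.2) ->
  (forall x, (forall p, G p -> rinner x p.1 = 0) -> x = 0) ->
  exists y, matching G x y /\ rinner y y = rinner x x.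
Proof.
move=> iso tot.
have [|u [v [/(iffLR (closed_near_pair _) (@closed_rinner_eq G)) uv uvP]]] :=
    @projection _ _ [set q | matching G q.1 q.2] x.
  split=> [p _|r p q hp hq s Gs]; first by rewrite !rinner0l.
  by rewrite /= !rinnerE hp// hq.
have xE : x = u + u.
  apply/eqP; rewrite addrC -subr_eq -subr_eq0; apply/eqP/tot => p Gp.
  rewrite rinnerDl rinnerNl (uvP p) ?uv ?subrr// => q Gq.
  by rewrite iso.
have := uvP (u, v) uv; rewrite xE addrK /= => uu.
exists (v + v); split=> [p Gp|]; last by rewrite !rinnerE uu.
by rewrite !rinnerE uv.
Qed.

Lemma isometry_extension (G : set (H * H)) :
  (forall p q, G p -> G q -> rinner p.1 q.1 = rinner p.2 q.2) ->
  (forall x, (forall p, G p -> rinner x p.1 = 0) -> x = 0) ->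
  (forall x, (forall p, G p -> rinner x p.2 = 0) -> x = 0) ->
  exists V W, [/\ cancel V W, cancel W V,
    forall x, rinner (V x) (V x) = rinner x x &
    forall x y, matching G x y <-> V x = y].
Proof.
move=> iso tot1 tot2.
have uniq2 x y y' : matching G x y -> matching G x y' -> y = y'.
  move=> xy xy'; apply/eqP; rewrite -subr_eq0; apply/eqP/tot2 => p Gp.
  by rewrite !rinnerE xy// xy'// subrr.
have uniq1 x x' y : matching G x y -> matching G x' y -> x = x'.
  move=> xy x'y; apply/eqP; rewrite -subr_eq0; apply/eqP/tot1 => p Gp.
  by rewrite !rinnerE -xy// -x'y// subrr.
have ex1 x := matching_exists x iso tot1.
have ex2 y : exists x, matching G x y.
  (* Surjectivity is existence for the transposed set. *)
  have [| |x [xy _]] := @matching_exists [set p | G (p.2, p.1)] y.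
  - by move=> p q Gp Gq; rewrite (iso _ _ Gp Gq).
  - by move=> x hx; apply: tot2 => p Gp; apply: (hx (p.2, p.1)); case: p Gp.
  by exists x => p Gp; rewrite (xy (p.2, p.1))//; case: p Gp.
pose V x := projT1 (cid (ex1 x)); pose W y := projT1 (cid (ex2 y)).
have VP x : matching G x (V x) by rewrite /V; case: cid => ? [].
have WP y : matching G (W y) y by rewrite /W; case: cid.
exists V, W; split=> [x|y|x|x y].
- exact: uniq1 (WP _) (VP _).
- exact: uniq2 (VP _) (WP _).
- by rewrite /V; case: cid => ? [].
- by split=> [xy|<-//]; apply: uniq2 xy.
Qed.

(* E plays the role of the real span of an orthonormal basis of K. *)
Lemma exists_real_form (K : set H) : exists E : set H,
  [/\ E `<=` K, forall e e', E e -> E e' -> rinner e ('i *: e') = 0 &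
    forall y, K y -> (forall e, E e -> rinner y ('i *: e) = 0) -> E y].
Proof.
pose P (E : set H) :=
  E `<=` K /\ forall e e', E e -> E e' -> rinner e ('i *: e') = 0.
have [|E [[EK Er] Emax]] := @Zorn_bigcup _ P.
  move=> F FP Ftot; split=> [e [X FX Xe]|e e' [X FX Xe] [X' FX' X'e']].
    by have [XK _] := FP _ FX; exact: XK.
  have [XX'|X'X] := Ftot _ _ FX FX'.
    by apply: (FP _ FX').2 => //; exact: XX'.
  by apply: (FP _ FX).2 => //; exact: X'X.
exists E; split=> // y Ky yE; apply: contrapT => nEy.
(* Adjoining y preserves the condition, as ⟨y, y⟩ is real, so maximality puts y in [E]. *)
apply: (Emax (E `|` [set y])).
  split; first by move=> e; left.
  by move=> h; apply: nEy; apply: h; right.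
split=> [e [/EK//|->//]|e e' [Ee|->] [Ee'|->]]; last exact: rinnerix.
- exact: Er.
- by rewrite rinnerC rinneriC yE ?oppr0.
- exact: yE.
Qed.

Lemma rinner_polar V : rlinear V -> (forall x, rinner (V x) (V x) = rinner x x) ->
  forall x y, rinner (V x) (V y) = rinner x y.
Proof.
move=> lV nV x y; have := nV (x + y).
rewrite rlinearD// !rinnerE !nV (rinnerC y) (rinnerC (V y)); lra.
Qed.

Lemma antilinear_total V : rlinear V ->
  (forall x, V ('i *: x) = - ('i *: V x)) -> antilinear_op (total_op V).
Proof.
move=> lV Vi; split; first by rewrite /total_op rlinear0.
move=> a b x y u v [<-] [<-]; congr Some.
have Va c z : V (c *: z) = Num.conj c *: V z.
  rewrite (scaleCE c z) (scaleCE (Num.conj c) (V z)).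
  rewrite (rlinearD _ _ lV) !(rlinearZ _ _ lV) Vi.
  by case: c => p q /=; rewrite rmorphN scaleNr scalerN.
by rewrite rlinearD// !Va.
Qed.

(* V maps S B x to T B x, and is extended to the orthogonal complement of the
   range of S B, the common kernel of S and T, as the conjugation fixing E. *)
Lemma exists_polar_isometry T T' S B : antilinear_op T -> linear_op S ->
  dual_pair T T' -> resolvent T T' B -> resolvent T' T B ->
  dual_pair S S -> resolvent S S B ->
  exists V W, [/\ cancel V W, cancel W V,
    rlinear V /\ forall x, rinner (V x) (V x) = rinner x x,
    forall x, V ('i *: x) = - ('i *: V x) & commuting V B] /\
    forall x, V (op_fun S B x) = op_fun T B x.
Proof.
move=> aT lS dT rT rT' dS rS.
set M := op_fun S B; set N := op_fun T B.
have lB := resolvent_lin dT rT; have lM := op_fun_lin dS rS.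
have lN := op_fun_lin dT rT.
have iB x : B ('i *: x) = 'i *: B x.
  have := resolvent_unique dS rS (linear_op_i lS (op_funE rS x))
    (linear_op_i lS (op_fun_adj rS x)).
  by rewrite -scalerDr addrC subrK.
have iM x : M ('i *: x) = 'i *: M x.
  have := linear_op_i lS (op_funE rS x).
  by rewrite -iB (op_funE rS) => -[].
have iN x : N ('i *: x) = - ('i *: N x).
  have := antilinear_op_i aT (op_funE rT x).
  by rewrite -iB (op_funE rT) => -[].
have [E [EK Er Emax]] := exists_real_form [set x | B x = x].
have ME e : E e -> M e = 0 by move/EK/(op_fun_ker dS rS).
have NE e : E e -> op_fun T' B e = 0.
  by move/EK/(op_fun_ker (dual_pairC dT) rT').
have sM := rinner_op_funl dS rS rS.
have sN := rinner_op_funl dT rT rT'.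
pose G := [set p : H * H | (exists x, p = (M x, N x)) \/
  exists2 e, E e & p = (e, e) \/ p = ('i *: e, - ('i *: e))].
have GM x : G (M x, N x) by left; exists x.
have GE e : E e -> G (e, e) by move=> Ee; right; exists e => //; left.
have GiE e : E e -> G ('i *: e, - ('i *: e)).
  by move=> Ee; right; exists e => //; right.
(* Orthogonality to i E puts x in [E], and x is then orthogonal to itself. *)
have tot x : B x = x -> (forall e, E e -> rinner x e = 0) ->
    (forall e, E e -> rinner x ('i *: e) = 0) -> x = 0.
  by move=> Kx xE xiE; apply/rinner_eq0/xE; exact: Emax.
have isoG p q : G p -> G q -> rinner p.1 q.1 = rinner p.2 q.2.
  have MiE x e : E e -> rinner (M x) ('i *: e) = 0.
    by move=> Ee; rewrite sM -/M iM ME// scaler0 rinner0r.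
  have NiE x e : E e -> rinner (N x) ('i *: e) = 0.
    move=> Ee; rewrite -[LHS]opprK -rinneriC -rinnerNl -iN sN NE//.
    by rewrite rinner0r.
  have MNE x e : E e -> rinner (M x) e = 0 /\ rinner (N x) e = 0.
    by move=> Ee; rewrite sM sN -/M ME// NE// !rinner0r.
  move=> [[x ->]|[e Ee [->|->]]] [[y ->]|[e' Ee' [->|->]]] //=.
  - by rewrite (rinner_op_fun dS rS) (rinner_op_fun dT rT).
  - by case: (MNE x _ Ee') => -> ->.
  - by rewrite rinnerNr MiE// NiE// oppr0.
  - by rewrite ![rinner e _]rinnerC; case: (MNE y _ Ee) => -> ->.
  - by rewrite rinnerNr Er// oppr0.
  - by rewrite rinnerNl ![rinner ('i *: e) _]rinnerC MiE// NiE// oppr0.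
  - by rewrite rinnerNl rinnerC Er// oppr0.
  - by rewrite rinnerNl rinnerNr opprK.
have [|  |V [W [VW WV nV VP]]] := isometry_extension isoG.
- move=> x xG; apply: tot.
  + apply/(op_fun_ker dS rS)/rinner_inj => z.
    by rewrite sM rinner0l; exact: xG _ (GM z).
  + by move=> e Ee; exact: xG _ (GE _ Ee).
  + by move=> e Ee; exact: xG _ (GiE _ Ee).
(* Orthogonality to the range of T B gives T' B x = 0, hence again B x = x. *)
- move=> x xG; apply: tot.
  + apply/(op_fun_ker (dual_pairC dT) rT')/rinner_inj => z.
    by rewrite rinnerC -sN rinner0l rinnerC; exact: xG _ (GM z).
  + by move=> e Ee; exact: xG _ (GE _ Ee).
  + move=> e Ee; apply/eqP; rewrite -oppr_eq0 -rinnerNr; apply/eqP.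
    exact: xG _ (GiE _ Ee).
have VG x : matching G x (V x) by apply/VP.
(* Up to a sign, [G] is stable under (i, - i); this makes V antilinear. *)
have Gi p : G p -> G (- ('i *: p.1), 'i *: p.2) \/ G ('i *: p.1, - ('i *: p.2)).
  move=> [[x ->]|[e Ee [->|->]]] /=.
  - by right; rewrite -iM -iN; exact: GM.
  - by right; exact: GiE.
  - by left; rewrite scalerN scaleii opprK; exact: GE.
exists V, W; split; last first.
  by move=> x; apply/VP => p Gp; exact/esym/(isoG _ _ (GM x) Gp).
split=> //; first split=> //.
- move=> r x y; apply/VP => p Gp.
  by rewrite !rinnerE !VG.
- move=> x; apply/VP => p Gp.
  rewrite rinnerNl !rinneriC opprK; case: (Gi p Gp) => /(VG x) /=.
    by move=> ->; rewrite rinnerNr.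
  by rewrite rinnerNr => <-; rewrite opprK.
- move=> x; apply/VP => p Gp.
  (* Stability of [G] under [B] in both components makes V commute with [B]. *)
  have GB : G (B p.1, B p.2).
    case: Gp => [[y ->]|[e Ee [->|->]]] /=.
    + by rewrite -(op_funC dT rT rT') -(op_funC dS rS rS); exact: GM.
    + by rewrite (EK _ Ee); exact: GE.
    + by rewrite rlinearN// iB (EK _ Ee); exact: GiE.
  by rewrite !(resolvent_sym dT rT) (VG x (_, _) GB).
Qed.

End Polar.

(** * Normal antilinear operators *)

Section Assembly.
Variables (R : realType) (H : hilbertType R).
Implicit Types (A T S N : operator H) (B C D V W Z M : H -> H) (x y z u v w : H).

Lemma op_mulA A T S : (A * (T * S) = (A * T) * S)%op.
Proof. by apply/funext => x; rewrite /op_mul; case: (S x). Qed.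

Lemma op_mul_idl V W T : cancel W V -> (total_op V * (total_op W * T) = T)%op.
Proof.
move=> WV; apply/funext => x; rewrite /op_mul /total_op.
by case: (T x) => //= y; rewrite WV.
Qed.

Lemma dense_total_op V : densely_defined (total_op V).
Proof. by move=> O [x Ox] _; exists x. Qed.

Lemma antiunitary_rlinear V : antiunitary V -> rlinear V.
Proof.
move=> [aV _ _] r x y.
by have := (antilinear_rlinear_op aV).2 r x y _ _ erefl erefl; case.
Qed.

Lemma antiunitary_rinner V x y : antiunitary V ->
  rinner (V x) (V y) = rinner x y.
Proof.
move=> auV; apply: rinner_polar; first exact: antiunitary_rlinear.
by case: auV => _ _ nV z; apply/complexI; rewrite -!sqr_normE nV.
Qed.

Lemma antiunitary_adj V : antiunitary V ->
  exists W, [/\ cancel V W, cancel W V & ((total_op V)^† = total_op W)%op].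
Proof.
move=> auV; have VV x y : rinner (V x) (V y) = rinner x y.
  exact: antiunitary_rinner.
have [aV [W VW WV] _] := auV; exists W; split=> //.
apply: op_ext => y u; rewrite antilinear_adjP//; last exact: dense_total_op.
split=> [yu|[<-] x v [<-]]; last by rewrite -{1}[y]WV VV.
congr Some; apply: rinner_inj => x.
by rewrite -VV WV rinnerC (yu x _ erefl) rinnerC.
Qed.

(** Both products reduce to S^2: T^† T = S V^† V S and T T^† = S V V^† S. *)
Lemma antilinear_normal_suff T S V : antiunitary V ->
  (T = total_op V * S /\ T = S * total_op V /\
   T^† = (total_op V)^† * S /\ T^† = S * (total_op V)^†)%op ->
  antilinear_normal T.
Proof.
move=> /antiunitary_adj[W [VW WV ->]] [TVS [TSV [T'WS T'SW]]].
rewrite /antilinear_normal [in LHS]T'SW [in LHS]TVS -op_mulA op_mul_idl//.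
have -> : (T * T^† = (S * total_op V) * (total_op W * S))%op by rewrite -TSV -T'WS.
by rewrite -op_mulA op_mul_idl.
Qed.

Lemma op_sqr_polar T S V :
  (T = total_op V * S)%op -> (T = S * total_op V)%op ->
  (T ² = (total_op V) ² * S ² /\ T ² = S ² * (total_op V) ²)%op.
Proof.
move=> TVS TSV; have VS : (total_op V * S = S * total_op V)%op by rewrite -TVS.
split; [rewrite TVS|rewrite TSV]; rewrite -!op_mulA; congr (_ * _)%op.
  by rewrite !op_mulA VS.
by rewrite !op_mulA VS.
Qed.

(** T' T = B^-1 - 1, domains included. *)
Lemma resolvent_mulP T T' B x y : dual_pair T T' -> resolvent T T' B ->
  (T' * T)%op x = Some y <-> B (x + y) = x.
Proof.
move=> dT rT; split=> [/op_mulP[u Tx T'u]|xy].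
  exact: (resolvent_unique dT rT) Tx T'u.
apply/op_mulP; exists (op_fun T B (x + y)); first by rewrite -(op_funE rT) xy.
by rewrite (op_fun_adj rT) xy addrC addKr.
Qed.

(** By [normal_graph], T x = y means U S B x = B y. Moving U to the right gives S x = U^-1 y;
    commuting it past S B gives S (U x) = y. *)
Lemma polar_factor T T' S B U Z : dual_pair T T' -> resolvent T T' B ->
  resolvent T' T B -> dual_pair S S -> resolvent S S B ->
  cancel U Z -> cancel Z U -> commuting U B -> commuting U (op_fun S B) ->
  (forall x, op_fun T B x = U (op_fun S B x)) ->
  (T = total_op U * S)%op /\ (T = S * total_op U)%op.
Proof.
move=> dT rT rT' dS rS UZ ZU UB UM TUM.
have SP := normal_graph dS rS rS.
split; apply: op_ext => x y; rewrite (normal_graph dT rT rT') TUM.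
  split=> [UMx|/op_mulP[u /SP Mx [<-]]]; last by rewrite Mx UB.
  apply/op_mulP; exists (Z y); last by rewrite /total_op ZU.
  by apply/SP; rewrite -[LHS]UZ UMx -{1}[y]ZU -UB UZ.
by rewrite UM -SP.
Qed.

Lemma antilinear_adj_rlinear T : antilinear_op T -> densely_defined T ->
  rlinear_op (T^†)%op.
Proof.
move=> aT dT; split; first by apply/antilinear_adjP => // x v _; rewrite !rinner0r.
move=> r x y u v /(antilinear_adjP _ _ aT dT) xu /(antilinear_adjP _ _ aT dT) yv.
apply/antilinear_adjP => // a b Tab.
by rewrite !rinnerE (xu _ _ Tab) (yv _ _ Tab).
Qed.

Lemma dual_pair_adj T : antilinear_op T -> densely_defined T ->
  dual_pair T (T^†)%op.
Proof.
move=> aT dT; split; [exact: antilinear_rlinear_op|exact: antilinear_adj_rlinear|].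
by move=> x u y v Tx /(antilinear_adjP _ _ aT dT); apply.
Qed.

Lemma adj_resolvent T : antilinear_op T -> densely_defined T -> closed_op T ->
  exists B, resolvent T (T^†)%op B.
Proof.
move=> aT dT cT; apply: von_neumann => //; first exact: antilinear_rlinear_op.
by move=> y u /antilinear_adjP; apply.
Qed.

Lemma op_abs_prop T : antilinear_op T -> densely_defined T -> closed_op T ->
  self_adjoint (`|T|%op) /\ positive_op (`|T|%op) /\ (`|T| ² = T^† * T)%op.
Proof.
move=> aT dT cT; have dTT := dual_pair_adj aT dT.
have [B rB] := adj_resolvent aT dT cT.
have [C [D CDP]] := exists_root_pair (resolvent_sym dTT rB)
  (resolvent_le dTT rB) (one_sub_resolvent_le dTT rB).
have injB := resolvent_inj dTT rB.
have T'i y u : (T^†)%op y = Some u -> (T^†)%op ('i *: y) = Some (- ('i *: u)).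
  move=> /(antilinear_adjP _ _ aT dT) yu; apply/antilinear_adjP => // x v Tx.
  rewrite -[LHS]opprK -rinneriC -rinnerNl (yu _ _ (antilinear_op_i aT Tx)).
  by rewrite rinneriC rinnerNr.
(* T and T^† both anticommute with i, so T^† T commutes with it, and so does [B] by uniqueness. *)
have iB : commuting ( *:%R 'i) B.
  move=> x; have := antilinear_op_i aT (op_funE rB x).
  have := T'i _ _ (op_fun_adj rB x).
  have [_ lT' _] := dTT.
  move/(rlinear_opB lT' lT'.1); rewrite !sub0r opprK.
  move=> h /(resolvent_unique dTT rB)/(_ h).
  by rewrite -scalerDr addrC subrK.
rewrite /op_abs /op_sqrt.
have [S0 S0P] : exists S, [/\ self_adjoint S, positive_op S & (S ² = T^† * T)%op].
  exists (root_op C D); split.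
  - exact: root_op_self_adjoint CDP injB iB.
  - exact: root_op_positive CDP injB iB.
  - apply: op_ext => x y; rewrite (root_op_sq CDP injB).
    by rewrite (resolvent_mulP _ _ dTT rB).
(* The root [S0] excludes the default value of [xget]. *)
by case: xgetP => [S _ []|/(_ S0)].
Qed.

Lemma self_adjoint_dual S : self_adjoint S -> dual_pair S S.
Proof.
move=> [lS dS aS]; split; [exact: linear_rlinear_op|exact: linear_rlinear_op|].
by move=> x u y v Sx; rewrite -{1}aS => /(linear_adjP _ _ lS dS); apply.
Qed.

Lemma normal_polar T : antilinear_op T -> densely_defined T -> closed_op T ->
  antilinear_normal T -> exists V, antiunitary V /\
  (T = total_op V * `|T| /\ T = `|T| * total_op V /\
   T^† = (total_op V)^† * `|T| /\ T^† = `|T| * (total_op V)^†)%op.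
Proof.
move=> aT dT cT nT; set S := (`|T|)%op.
have [saS [pS SS]] := op_abs_prop aT dT cT; rewrite -/S in saS pS SS.
have dTT := dual_pair_adj aT dT; have dSS := self_adjoint_dual saS.
have [B rT] := adj_resolvent aT dT cT.
(* A resolvent depends only on the product A' A, so normality and |T|^2 = T^† T give the same [B]
   for all three pairs. *)
have resP A A' : (A' * A = T^† * T)%op -> resolvent A A' B.
  move=> AA x; have : (T^† * T)%op (B x) = Some (x - B x).
    by apply/op_mulP; case: (rT x) => u; exists u.
  by rewrite -AA => /op_mulP[u]; exists u.
have rT' := resP _ _ (esym nT); have rS := resP _ _ SS.
have [lS _ _] := saS.
have [V [W [[VW WV [lV nV] iV VB] VM]]] :=
  exists_polar_isometry aT lS dTT rT rT' dSS rS.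
have auV : antiunitary V.
  split; [exact: antilinear_total|by exists W|].
  by move=> x; rewrite !normE /rnorm nV.
have [C [D CDP]] := exists_root_pair (resolvent_sym dTT rT)
  (resolvent_le dTT rT) (one_sub_resolvent_le dTT rT).
have MCD := root_unique CDP dSS rS.
have {}MCD x : op_fun S B x = C (D x).
  apply: MCD => a v Sa; have := pS _ _ Sa.
  by rewrite inner_rinner lecE => /andP[].
have VMc : commuting V (op_fun S B).
  have [VC VD] : commuting V C /\ commuting V D.
    case: CDP => _; apply=> //; apply: bounded_le => x.
    by rewrite ler_rnorm nV.
  by move=> x; rewrite !MCD VC VD.
have WC Z : commuting V Z -> commuting W Z.
  by move=> VZ x; rewrite -{1}[x]WV -VZ VW.
have VV := rinner_polar lV nV.
have sM := rinner_op_funl dSS rS rS.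
(* The adjoint of T B = V S B, as S B is symmetric and commutes with W. *)
have WM x : op_fun (T^†)%op B x = W (op_fun S B x).
  apply: rinner_inj => z; rewrite rinnerC -(rinner_op_funl dTT rT rT') -VM.
  by rewrite -[x in LHS]WV VV sM WC// rinnerC.
have [W' [VW' WV' adjV]] := antiunitary_adj auV.
have eW : W' = W by apply/funext => x; rewrite -{1}[x]WV VW'.
exists V; split=> //; rewrite adjV eW.
have [TVS TSV] := polar_factor dTT rT rT' dSS rS VW WV VB VMc (fun x => esym (VM x)).
have [T'WS T'SW] := polar_factor (dual_pairC dTT) rT' rT dSS rS WV VW (WC _ VB)
  (WC _ VMc) WM.
by split.
Qed.

Lemma sqr_linear_normal T : antilinear_op T -> densely_defined T -> closed_op T ->
  antilinear_normal T -> linear_normal (T ²)%op.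
Proof.
move=> aT dT cT nT.
have [V [auV [TVS [TSV [T'WS T'SW]]]]] := normal_polar aT dT cT nT.
have [saS [_ SS]] := op_abs_prop aT dT cT; move: TVS TSV T'WS T'SW saS SS.
set S := (`|T|)%op => TVS TSV T'WS T'SW saS SS.
have dTT := dual_pair_adj aT dT.
have [B rT] := adj_resolvent aT dT cT.
have sB := resolvent_sym dTT rT; have lB := resolvent_lin dTT rT.
have SSP x y : (S ²)%op x = Some y <-> B (x + y) = x.
  by rewrite SS (resolvent_mulP _ _ dTT rT).
have [W [VW WV adjV]] := antiunitary_adj auV.
have VV x y : rinner (V x) (V y) = rinner x y by exact: antiunitary_rinner.
have WVr x y : rinner (W x) y = rinner x (V y) by rewrite -VV WV.
have [T2 _] := op_sqr_polar TVS TSV.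
rewrite adjV in T'WS T'SW.
have [_ T'2] := op_sqr_polar T'WS T'SW.
(* T^2 = V^2 S^2 with S^2 = B^-1 - 1. *)
have TTP x y : (T ²)%op x = Some y <-> B (x + W (W y)) = x.
  rewrite T2 -SSP; split=> [/op_mulP[u Su [<-]]|SSx]; first by rewrite !VW.
  by apply/op_mulP; exists (W (W y)) => //; rewrite /op_mul /total_op /= !WV.
have lT2 : linear_op (T ²)%op.
  case: aT => T0 TD; split; first by rewrite /op_mul T0.
  move=> a b x y u v /op_mulP[x' Tx Tx'] /op_mulP[y' Ty Ty'].
  apply/op_mulP; exists (Num.conj a *: x' + Num.conj b *: y'); first exact: TD.
  by rewrite (TD _ _ _ _ _ _ Tx' Ty') !conjCK.
have TTB z : (T ²)%op (B z) = Some (V (V (z - B z))).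
  by apply/TTP; rewrite !VW addrC subrK.
have dT2 : densely_defined (T ²)%op.
  apply: total_dense => [|r x y|x xP]; rewrite /dom /=.
  - by rewrite lT2.1.
  - case Ex: ((T ²)%op x) => [u|//]; case Ey: ((T ²)%op y) => [v|//] _ _.
    by rewrite ((linear_rlinear_op lT2).2 _ _ _ _ _ Ex Ey).
  apply: (resolvent_inj dTT rT); apply/rinner_inj => z.
  by rewrite sB rinner0l; apply: xP; rewrite /dom /= TTB.
have VVr x y : rinner (W (W x)) y = rinner x (V (V y)) by rewrite !WVr.
split=> //.
  (* The graph equation B W^2 y = x - B x, tested against every z, becomes a family of closed
     conditions. *)
  rewrite /closed_op; have -> : graph (T ²)%op = [set q : H * H | forall p,
      [set p : H * H | exists z, p = (z - B z, V (V (B z)))] p ->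
      rinner q.2 p.2 = rinner q.1 p.1].
    apply/seteqP; split=> [[x y] /TTP /= xy _ [z ->]|[x y] /= h].
      have BW : B (W (W y)) = x - B x 
        by apply/eqP; rewrite eq_sym subr_eq addrC -rlinearD// xy.
      by rewrite /= -VVr -sB BW !rinnerE sB.
    apply/TTP/rinner_inj => z; have := h _ (ex_intro _ z erefl).
    by rewrite /= -VVr sB !rinnerE => ->; rewrite addrC subrK.
  exact: closed_rinner_eq.
have -> : linear_adj (T ²)%op = (T^† ²)%op.
  apply: op_ext => y u; rewrite linear_adjP//.
  have -> : (T^† ²)%op y = Some u <-> B (W (W y) + u) = W (W y).
    by rewrite T'2 -SSP.
  split=> [h|yu x v /TTP xv].
    (* Testing the adjoint relation on the vectors B z already determines it. *)
    apply: rinner_inj => z; have := h _ _ (TTB z).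
    rewrite rinnerC -VVr [rinner (B z) u]rinnerC sB !rinnerE => <-.
    by rewrite addrC subrK.
  have -> : rinner v y = rinner (W (W v)) (W (W y)) by rewrite VVr !WV.
  have : rinner (x + W (W v)) (W (W y)) = rinner x (W (W y) + u).
    by rewrite -{1}yu -sB xv.
  by rewrite !rinnerE; lra.
rewrite /antilinear_normal in nT.
(* Exchanging the inner pair by normality turns the two sides into (T^† T)^2 and (T T^†)^2. *)
have -> : ((T^† * T^†) * (T * T) = T^† * ((T^† * T) * T))%op by rewrite !op_mulA.
have -> : ((T * T) * (T^† * T^†) = T * ((T * T^†) * T^†))%op by rewrite !op_mulA.
rewrite [in LHS]nT -[in RHS]nT -!op_mulA.
by rewrite [LHS]op_mulA [RHS]op_mulA nT.
Qed.

End Assembly.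

Theorem theorem11 (R : realType) (H : hilbertType R) (T : operator H)
    (hlin : antilinear_op T) (hdense : densely_defined T)
    (hclosed : closed_op T) :
  (antilinear_normal T <->
     exists V : H -> H, antiunitary V /\
       (T = total_op V * `|T| /\ T = `|T| * total_op V /\
        T^† = (total_op V)^† * `|T| /\ T^† = `|T| * (total_op V)^†)%op) /\
  (antilinear_normal T ->
     linear_normal (T ²)%op /\
     forall V : H -> H, antiunitary V ->
       (T = total_op V * `|T| /\ T = `|T| * total_op V /\
        T^† = (total_op V)^† * `|T| /\ T^† = `|T| * (total_op V)^†)%op ->
       (T ² = (total_op V) ² * `|T| ² /\
        T ² = `|T| ² * (total_op V) ²)%op).
Proof.
split=> [|nT]; first split=> [|[V [auV eqs]]].
- exact: normal_polar.
- exact: antilinear_normal_suff auV eqs.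
- split; first exact: sqr_linear_normal.
  by move=> V _ [TVS [TSV _]]; exact: op_sqr_polar.
Qed.
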